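(* There are constants $c_0,c_1,c_2\geq 1$ such that the following holds. There is an infinite set $K$ of integers $k\geq c_0$ such that for each $k\in K$ there is a class $\mathcal{G}_k$ of graphs, each of treewidth at most $k$, such that for every $G\in\mathcal{G}_k$ and every $V\subseteq V(G)$ with $|V|\geq k^{c_1}$, the partial matching width of $V$ in $G$ is at least $(k\log|V|)/c_2$.
   Context: All graphs are finite and simple; $\log$ is the binary logarithm. Partial matching width: for a graph $G$ and $V\subseteq V(G)$, the partial matching width of $V$ (with respect to $G$) is the largest integer $k\geq 0$ such that for every ordering $(v_1,\dots,v_m)$ of the elements of $V$ there is an index $j\in\{0,\dots,m\}$ such that $G$ has a matching of size at least $k$ each of whose edges has one endpoint in the prefix set $\{v_1,\dots,v_j\}$ and the other endpoint in $V(G)\setminus\{v_1,\dots,v_j\}$. *)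

(* Defs.v *)
From mathcomp Require Import all_boot.
From Stdlib Require Import Reals.
Set Implicit Arguments. Unset Strict Implicit. Unset Printing Implicit Defensive.

Definition simple_graph (T : finType) (e : rel T) : Prop :=
  symmetric e /\ irreflexive e.

Definition has_cycle (I : finType) (t : rel I) : Prop :=
  exists (x : I) (p : seq I), [/\ path t x p, last x p = x, uniq p & 3 <= size p].

Definition is_tree (I : finType) (t : rel I) : Prop :=
  [/\ 0 < #|I|, symmetric t, irreflexive t,
      (forall i j : I, connect t i j) & ~ has_cycle t].

Definition induced_connected (I : finType) (t : rel I) (S : {set I}) : Prop :=
  forall i j, i \in S -> j \in S ->
    connect [rel a b | [&& t a b, a \in S & b \in S]] i j.

Definition tree_decomposition (T : finType) (e : rel T)
    (I : finType) (t : rel I) (B : I -> {set T}) : Prop :=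
  [/\ is_tree t,
      (forall v : T, exists i, v \in B i),
      (forall u v : T, e u v -> exists i, (u \in B i) && (v \in B i))
    & (forall v : T, induced_connected t [set i | v \in B i])].

Definition treewidth_le (T : finType) (e : rel T) (k : nat) : Prop :=
  exists (I : finType) (t : rel I) (B : I -> {set T}),
    tree_decomposition e t B /\ forall i, #|B i| <= k.+1.

Definition cross_matching (T : finType) (e : rel T) (P : {set T}) (M : {set T * T}) : bool :=
  [forall p in M, [&& e p.1 p.2, p.1 \in P & p.2 \notin P]] &&
  [forall p in M, forall q in M, (p != q) ==> ((p.1 != q.1) && (p.2 != q.2))].

Definition pmw_ge (T : finType) (e : rel T) (V : {set T}) (k : nat) : bool :=
  [forall s : (#|V|).-tuple T, perm_eq s (enum V) ==>
     [exists j : 'I_(#|V|).+1, exists M : {set T * T},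
        cross_matching e [set x in take j s] M && (k <= #|M|)]].

(* partial matching width = the largest such k (matchings have size <= #|T|) *)
Definition pmw (T : finType) (e : rel T) (V : {set T}) : nat :=
  \max_(k < #|T|.+1 | pmw_ge e V k) k.

Definition log2 (x : R) : R := (ln x / ln 2)%R.

(* Main.v *)
(** Blow up every node of a complete binary tree to a clique of size [p], and
    every tree edge to a complete bipartite graph. The bags "node and parent"
    give treewidth at most [2p]. The sets of tree nodes with [b] boundary edges
    have sizes that are signed sums of about [2b] powers of two, because each
    boundary edge adds or removes a complete subtree, of size [2^i - 1]. The
    number [(4^t - 1) / 3] is not a signed sum of fewer than [t] powers of two.
    Hence every vertex set of size [p (4^t - 1) / 3] has an edge cut of order
    [p^2 t], and, as all degrees are [O(p)], a crossing matching of order [p t].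
    For any ordering of [V] it is therefore enough to look at the prefix of
    that size, with [t] of order [log |V|]. *)

Require Import Defs.
From Stdlib Require Import Reals ZArith Lra.
From mathcomp Require Import all_boot zify.
Set Implicit Arguments. Unset Strict Implicit. Unset Printing Implicit Defensive.

(* The imports above leave the key [R] bound to [ring_scope]. *)
Delimit Scope R_scope with R.

(** * Signed sums of powers of two *)

Inductive signed_pow_sum : nat -> Z -> Prop :=
| SignedPow0 : signed_pow_sum 0 0
| SignedPowD b i z : signed_pow_sum b z -> signed_pow_sum b.+1 (z + Z.of_nat (2 ^ i))
| SignedPowB b i z : signed_pow_sum b z -> signed_pow_sum b.+1 (z - Z.of_nat (2 ^ i)).

Lemma signed_pow_sumD a b y z :
  signed_pow_sum a y -> signed_pow_sum b z -> signed_pow_sum (a + b) (y + z).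
Proof.
move=> Ha; elim=> [|c i u _ IH|c i u _ IH].
- by rewrite addn0 Z.add_0_r.
- by rewrite addnS Z.add_assoc; constructor.
- by rewrite addnS Z.add_sub_assoc; constructor.
Qed.

Lemma signed_pow_sum_unary (u : Z) : signed_pow_sum (Z.abs_nat u) u.
Proof.
have [n Hn] : exists n, u = Z.of_nat n \/ u = (- Z.of_nat n)%Z.
  by exists (Z.abs_nat u); lia.
elim: n u Hn => [|n IH] u Hn.
  have -> : u = 0%Z by lia.
  exact: SignedPow0.
case: Hn => ->.
  have -> : Z.abs_nat (Z.of_nat n.+1) = (Z.abs_nat (Z.of_nat n)).+1 by lia.
  have -> : Z.of_nat n.+1 = (Z.of_nat n + Z.of_nat (2 ^ 0))%Z by lia.
  by constructor; apply: IH; left.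
have -> : Z.abs_nat (- Z.of_nat n.+1) = (Z.abs_nat (- Z.of_nat n)).+1 by lia.
have -> : (- Z.of_nat n.+1 = - Z.of_nat n - Z.of_nat (2 ^ 0))%Z by lia.
by constructor; apply: IH; right.
Qed.

(* [u] collects the terms [1] and [-1]. *)
Lemma signed_pow_sum_split b z : signed_pow_sum b z ->
  exists u c y, [/\ z = (u + 2 * y)%Z, Z.abs_nat u + c <= b & signed_pow_sum c y].
Proof.
elim=> [|a i w _ [u [c [y [-> le_b Hy]]]]|a i w _ [u [c [y [-> le_b Hy]]]]].
- by exists 0%Z, 0, 0%Z; split => //; constructor.
- case: i => [|i].
    by exists (u + 1)%Z, c, y; split=> //; lia.
  exists u, c.+1, (y + Z.of_nat (2 ^ i))%Z; split; [rewrite expnS; lia|lia|].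
  by constructor.
- case: i => [|i].
    by exists (u - 1)%Z, c, y; split=> //; lia.
  exists u, c.+1, (y - Z.of_nat (2 ^ i))%Z; split; [rewrite expnS; lia|lia|].
  by constructor.
Qed.

(* [(4^t - 1) / 3], that is, [0101...01] in binary. *)
Fixpoint quarter_sum t := if t is t'.+1 then (4 * quarter_sum t').+1 else 0.

Lemma quarter_sum_le t : quarter_sum t <= 4 ^ t.
Proof.
suff : quarter_sum t < 4 ^ t by lia.
by elim: t => //= t IH; rewrite expnS; lia.
Qed.

(** Induction on [t], splitting off the two lowest binary digits. The equation
    [4 * q = u + 2 * v - 1] makes [u] odd and forces [|q| + 1 <= |u| + |v|], so passing from [t.+1]
    to [t] saves at least one summand. *)
Lemma signed_pow_sum_quarter b t :
  signed_pow_sum b (Z.of_nat (quarter_sum t)) -> t <= b.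
Proof.
elim: t b => [|t IH] b //= /signed_pow_sum_split[u [c [y [Ez le_b]]]].
case/signed_pow_sum_split=> v [d [x [Ey le_c Hx]]].
set q := (Z.of_nat (quarter_sum t) - x)%Z.
have Hq : signed_pow_sum (Z.abs_nat q + d) (Z.of_nat (quarter_sum t)).
  have -> : Z.of_nat (quarter_sum t) = (q + x)%Z by rewrite /q; lia.
  exact: signed_pow_sumD (signed_pow_sum_unary q) Hx.
have Eq : (4 * q = u + 2 * v - 1)%Z by rewrite /q; lia.
have := IH _ Hq; lia.
Qed.

(** * Complete binary trees and the sizes of their node sets *)

Fixpoint btree h : finType :=
  if h is h'.+1 then (unit + (btree h' + btree h'))%type : finType else unit.

Fixpoint broot h : btree h := if h is h'.+1 then inl tt else tt.

(** The root is its own parent, so it contributes 0 when changes between a node and its parent are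
    counted over all nodes. *)
Fixpoint bparent h : btree h -> btree h :=
  if h is h'.+1 return btree h -> btree h then fun x =>
    match x with
    | inl _ => inl tt
    | inr (inl y) => if y == broot h' then inl tt else inr (inl (bparent y))
    | inr (inr y) => if y == broot h' then inl tt else inr (inr (bparent y))
    end
  else fun x => x.

Fixpoint bdepth h : btree h -> nat :=
  if h is h'.+1 return btree h -> nat then fun x =>
    match x with
    | inl _ => 0
    | inr (inl y) => (bdepth y).+1
    | inr (inr y) => (bdepth y).+1
    end
  else fun _ => 0.

Lemma bparent_root h : bparent (broot h) = broot h.
Proof. by case: h. Qed.

Lemma bdepth_parent h (a : btree h) : a != broot h -> bdepth (bparent a) < bdepth a.
Proof.
elim: h a => [|h IH] /=; first by case.
case=> [[]|[y|y]] //= _; case: eqP => //= /eqP; exact: IH.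
Qed.

(** Serves the degree bound. The root joins the two possible children in the list because it is its
    own parent. *)
Lemma bparent_children h (a : btree h) :
  exists l r, forall c, bparent c = a -> c \in [:: broot h; l; r].
Proof.
elim: h a => [|h IH] /=; first by exists tt, tt; case.
case=> [[]|[a|a]].
- exists (inr (inl (broot h))), (inr (inr (broot h))) => -[[]|[y|y]] //=;
    by case: eqP => // -> _; rewrite !inE eqxx ?orbT.
- have [l [r Hlr]] := IH a.
  exists (inr (inl l)), (inr (inl r)) => -[[]|[y|y]] //=; case: eqP => // ny [/Hlr].
  by rewrite !inE => /or3P[/eqP//|/eqP->|/eqP->]; rewrite eqxx ?orbT.
- have [l [r Hlr]] := IH a.
  exists (inr (inr l)), (inr (inr r)) => -[[]|[y|y]] //=; case: eqP => // ny [/Hlr].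
  by rewrite !inE => /or3P[/eqP//|/eqP->|/eqP->]; rewrite eqxx ?orbT.
Qed.

Lemma card_btree_gt h : h < #|btree h|.
Proof.
elim: h => [|h IH] /=; first by rewrite card_unit.
by rewrite !card_sum card_unit; lia.
Qed.

Lemma sum_unit (F : unit -> nat) : \sum_(x : unit) F x = F tt.
Proof. by rewrite (bigD1 tt) //= big1 ?addn0 //; case. Qed.

(** The subtracted term is the size [r] would have if no edge were a boundary edge: everything or
    nothing, as the root decides. Each boundary edge corrects it by one subtree size [2^i - 1],
    which costs two signed powers. *)
Lemma btree_signed_pow_sum h (r : pred (btree h)) :
  signed_pow_sum (2 * \sum_(c : btree h) (r c != r (bparent c)))
    (Z.of_nat (\sum_(c : btree h) r c) - Z.of_nat (r (broot h) * (2 ^ h.+1 - 1))).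
Proof.
elim: h r => [|h IH] r /=.
  by rewrite !sum_unit eqxx muln0 muln1 Z.sub_diag; constructor.
rewrite !big_sumType /= !sum_unit eqxx add0n.
(* The estimate for one subtree, embedded by [g], but measured against the new root; this brings in
   the edge joining the two roots. *)
have branch (g : btree h -> btree h.+1) :
  signed_pow_sum (2 * \sum_(c : btree h)
     (r (g c) != r (if c == broot h then inl tt else g (bparent c))))
   (Z.of_nat (\sum_(c : btree h) r (g c)) - Z.of_nat (r (inl tt) * (2 ^ h.+1 - 1))).
  have Hs := IH (r \o g).
  rewrite (bigD1 (broot h)) //= bparent_root eqxx add0n in Hs.
  rewrite (bigD1 (broot h)) //= eqxx.
  rewrite [X in _ + X](eq_bigr (fun c => nat_of_bool (r (g c) != r (g (bparent c))))); last first.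
    by move=> c /negPf->.
  (* The reference terms of the two roots differ only if their edge is a boundary edge, and then by
     [2^(h+1) - 1] up to sign. *)
  have E : forall e : bool, (r (g (broot h)) != r (inl tt)) = e ->
    signed_pow_sum (2 * e) (Z.of_nat (r (g (broot h)) * (2 ^ h.+1 - 1))
       - Z.of_nat (r (inl tt) * (2 ^ h.+1 - 1))).
    have pos : 0 < 2 ^ h.+1 by rewrite expn_gt0.
    case=> /=.
      have P := SignedPowB 0 (SignedPowD h.+1 SignedPow0).
      have N := SignedPowD 0 (SignedPowB h.+1 SignedPow0).
      case: (r (g _)); case: (r (inl tt)) => //= _.
      + by congr signed_pow_sum: P; lia.
      + by congr signed_pow_sum: N; lia.
    by move/negbFE/eqP->; rewrite Z.sub_diag; constructor.
  have := signed_pow_sumD Hs (E _ erefl).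
  rewrite -mulnDr addnC.
  by congr signed_pow_sum; rewrite Z.add_sub_assoc Z.sub_add.
have := signed_pow_sumD (branch (fun x => inr (inl x))) (branch (fun x => inr (inr x))).
rewrite -mulnDr /=; congr signed_pow_sum.
have pos : 0 < 2 ^ h.+1 by rewrite expn_gt0.
rewrite [2 ^ h.+2]expnS; move: (2 ^ h.+1) pos => m pos.
move: (\sum_i r (inr (inl i))) (\sum_i r (inr (inr i))) => a b.
by case: (r (inl tt)); rewrite ?mul1n ?mul0n; lia.
Qed.

(** * From edge cuts to crossing matchings *)

Definition edge_cut (T : finType) (e : rel T) (P : {set T}) : {set T * T} :=
  [set q | [&& e q.1 q.2, q.1 \in P & q.2 \notin P]].

(** Every cut edge shares an endpoint with an edge of a maximum crossing matching, and at most
    [2 * D] cut edges meet a given matching edge. *)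
Lemma edge_cut_matching (T : finType) (e : rel T) (P : {set T}) (D : nat) :
  symmetric e -> (forall x, #|[set y | e x y]| <= D) ->
  exists2 M, cross_matching e P M & #|edge_cut e P| <= 2 * D * #|M|.
Proof.
move=> sym_e degD.
have M0 : cross_matching e P set0.
  by apply/andP; split; apply/forallP=> q; rewrite inE.
have [M HM maxM] := arg_maxnP (fun M : {set T * T} => #|M|) M0.
exists M => //.
pose F (m : T * T) :=
  setX [set m.1] [set y | e m.1 y] :|: setX [set x | e m.2 x] [set m.2].
have sub : edge_cut e P \subset \bigcup_(m in M) F m.
  apply/subsetP=> q; rewrite inE => /and3P[eq q1P q2P].
  apply/bigcupP; have [/exists_inP[m mM mq]|] :=
    boolP [exists m in M, (m.1 == q.1) || (m.2 == q.2)].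
    exists m => //; rewrite !inE.
    by case/orP: mq => /eqP->; rewrite eqxx ?[e q.2 _]sym_e eq ?orbT.
  rewrite negb_exists_in => /forall_inP freeM.
  have notM m : m \in M -> (m.1 != q.1) && (m.2 != q.2).
    by move/freeM; rewrite negb_or.
  have qM : q \notin M by apply/negP=> /notM; rewrite eqxx.
  suff /maxM : cross_matching e P (q |: M) by rewrite cardsU1 qM; lia.
  case/andP: HM => /forall_inP cutM /forall_inP matM.
  apply/andP; split; apply/forall_inP=> m.
    by case/setU1P=> [->|/cutM//]; apply/and3P.
  case/setU1P=> [->|mM]; apply/forall_inP=> m'; case/setU1P=> [->|m'M].
  - by rewrite eqxx.
  - by apply/implyP=> _; rewrite ![q.1 == _]eq_sym ![q.2 == _]eq_sym; apply: notM.
  - by apply/implyP=> _; apply: notM.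
  - by have /forall_inP/(_ _ m'M) := matM _ mM.
have cardU : #|\bigcup_(m in M) F m| <= \sum_(m in M) #|F m|.
  elim/big_rec2: _ => [|m S a _ IH]; first by rewrite cards0.
  by apply: leq_trans (leq_card_setU _ _) _; rewrite leq_add2l.
apply: leq_trans (subset_leq_card sub) (leq_trans cardU _).
rewrite mulnC -sum_nat_const; apply: leq_sum => m _.
apply: leq_trans (leq_card_setU _ _) _.
rewrite !cardsX !cards1 mul1n muln1.
have := degD m.1; have := degD m.2; lia.
Qed.

(** * Clique blow-ups of trees: treewidth and degrees *)

Definition tree_rel (I : finType) (par : I -> I) : rel I :=
  [rel a b | (a != b) && ((par a == b) || (par b == a))].

Definition blowup_rel (I : finType) (par : I -> I) (p : nat) : rel (I * 'I_p) :=
  [rel x y | (x != y) && [|| x.1 == y.1, par x.1 == y.1 | par y.1 == x.1]].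

Lemma blowup_rel_simple (I : finType) (par : I -> I) (p : nat) :
  simple_graph (@blowup_rel I par p).
Proof.
split=> [x y|x]; rewrite /blowup_rel /=; last by rewrite eqxx.
by rewrite eq_sym [x.1 == _]eq_sym [(par x.1 == _) || _]orbC.
Qed.

Lemma tree_rel_sym (I : finType) (par : I -> I) : symmetric (tree_rel par).
Proof. by move=> a b; rewrite /tree_rel /= eq_sym orbC. Qed.

(* In a cycle, both neighbours of a vertex of maximal rank would be its parent. *)
Lemma tree_rel_is_tree (I : finType) (par : I -> I) (root : I) (rank : I -> nat) :
  par root = root -> (forall a, a != root -> rank (par a) < rank a) ->
  is_tree (tree_rel par).
Proof.
move=> par_root rank_par.
have tree_symC : connect_sym (tree_rel par).
  by apply/sym_connect_sym/tree_rel_sym.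
split.
- by apply/card_gt0P; exists root.
- exact: tree_rel_sym.
- by move=> a; rewrite /tree_rel /= eqxx.
- suff to_root a : connect (tree_rel par) a root.
    by move=> i j; apply: connect_trans (to_root i) _; rewrite tree_symC.
  have [n] := ubnP (rank a); elim: n a => // n IH a le_n.
  have [->|/rank_par lt_a] := eqVneq a root; first exact: connect0.
  apply: connect_trans (IH (par a) _); last by lia.
  apply: connect1; rewrite /tree_rel /= eqxx andbT.
  by apply/eqP=> Ea; rewrite -Ea ltnn in lt_a.
- case=> x [s [path_s last_s uniq_s size_s]].
  have cyc_s : cycle (tree_rel par) s.
    by rewrite (cycle_path x) last_s.
  have s0 : head x s \in s by case: s size_s {path_s last_s uniq_s cyc_s} => //= a s; rewrite inE eqxx.
  have [y ys max_y] := arg_maxnP (P := mem s) rank s0.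
  have up z : z \in s -> tree_rel par y z -> z = par y.
    move=> zs /andP[y'z /orP[/eqP//|/eqP Ey]].
    have z'root : z != root.
      by apply: contraNneq y'z => Ez; rewrite -Ey Ez par_root.
    by have := max_y z zs; have := rank_par _ z'root; rewrite Ey /=; lia.
  have [i s' Es] := rot_to ys.
  have mem_s z : z \in y :: s' -> z \in s by rewrite -Es mem_rot.
  have uniq_s' : uniq (y :: s') by rewrite -Es rot_uniq.
  have size_s' : 2 < size (y :: s') by rewrite -Es size_rot.
  have cyc_s' : cycle (tree_rel par) (y :: s') by rewrite -Es rot_cycle.
  case: s' {Es} mem_s uniq_s' size_s' cyc_s' => [|z [|w s']] // mem_s.
  rewrite [cycle _ _]/= rcons_path => /= /and3P[_ z_uniq _] _ /andP[yz /and3P[_ _ wy]].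
  have Ez : z = par y by apply: (up _ _ yz); apply: mem_s; rewrite !inE eqxx orbT.
  have El : last w s' = par y.
    apply: up; first by apply: mem_s; rewrite !inE -in_cons mem_last !orbT.
    by rewrite tree_rel_sym.
  by move: z_uniq; rewrite Ez -El mem_last.
Qed.

Lemma blowup_treewidth (I : finType) (par : I -> I) (p : nat) :
  is_tree (tree_rel par) -> treewidth_le (@blowup_rel I par p) (2 * p).
Proof.
move=> tree_par.
pose B (a : I) : {set I * 'I_p} := setX [set a; par a] setT.
exists I, (tree_rel par), B; split; last first.
  move=> a; rewrite cardsX cardsT card_ord cards2.
  by case: (a != par a); lia.
split=> //.
- by move=> v; exists v.1; rewrite !inE eqxx.
- move=> u v /andP[_ /or3P[]/eqP E].
  + by exists u.1; rewrite !inE E !eqxx.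
  + by exists u.1; rewrite !inE E !eqxx orbT.
  + by exists v.1; rewrite !inE E !eqxx orbT.
(* The bags containing [v] belong to [v.1] and its children, which form a star around [v.1]. *)
- move=> v; set S := [set i | _].
  pose t := [rel a b | [&& tree_rel par a b, a \in S & b \in S]].
  have symt : connect_sym t.
    apply: sym_connect_sym => a b; rewrite /t [in LHS]/= [in RHS]/=.
    by rewrite tree_rel_sym [(a \in S) && _]andbC.
  have vS : v.1 \in S by rewrite !inE eqxx.
  suff to_v i : i \in S -> connect t i v.1.
    by move=> i j iS jS; apply: connect_trans (to_v i iS) _; rewrite symt; apply: to_v.
  move=> iS; have := iS; rewrite !inE andbT => /orP[]/eqP Ev.
    by rewrite Ev; apply: connect0.
  have [->|i'v] := eqVneq i v.1; first exact: connect0.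
  apply: connect1; rewrite /t /= iS vS !andbT.
  by rewrite /tree_rel /= i'v Ev eqxx.
Qed.

(** All neighbours of [x] lie in the cliques of the five nodes listed in [N]. *)
Lemma blowup_degree (I : finType) (par : I -> I) (root : I) (p : nat) :
  (forall a, exists l r, forall c, par c = a -> c \in [:: root; l; r]) ->
  forall x, #|[set y | @blowup_rel I par p x y]| <= 5 * p.
Proof.
move=> children x; have [l [r Hlr]] := children x.1.
pose N := [:: x.1; par x.1; root; l; r].
have sub : [set y | blowup_rel par x y] \subset setX [set a in N] setT.
  apply/subsetP=> y; rewrite in_set => /andP[_ /or3P[]/eqP E].
  + by rewrite !inE E eqxx.
  + by rewrite !inE E eqxx orbT.
  + by have := Hlr _ E; rewrite !inE => /or3P[]->; rewrite ?orbT.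
apply: leq_trans (subset_leq_card sub) _.
rewrite cardsX cardsT card_ord leq_mul2r cardsE.
by rewrite (leq_trans (card_size N)) ?orbT.
Qed.

(** * Edge cuts of the blown-up tree *)

Lemma card_slices (I J : finType) (P : {set I * J}) :
  #|P| = \sum_a #|[set i | (a, i) \in P]|.
Proof.
rewrite -sum1_card (eq_bigl (fun x => (x.1, x.2) \in P)); last by case.
rewrite big_mkcond -(pair_bigA _ (fun a i => if (a, i) \in P then 1 else 0)) /=.
by apply: eq_bigr => a _; rewrite -big_mkcond sum1dep_card.
Qed.

Definition slice (I : finType) (p : nat) (P : {set I * 'I_p}) (a : I) : nat :=
  #|[set i | (a, i) \in P]|.

Lemma slice_le (I : finType) (p : nat) (P : {set I * 'I_p}) (a : I) : slice P a <= p.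
Proof. by rewrite -[leqRHS]card_ord max_card. Qed.

(** Each [a] selects the cliques of [g1 a] and [g2 a], which are completely joined; injectivity
    keeps the cut edges of different [a] apart. Taking [id] or the parent map for [g1] and [g2]
    covers edges inside cliques and along tree edges in both directions. *)
Lemma blowup_cut_ge (I : finType) (par : I -> I) (p : nat) (P : {set I * 'I_p})
    (g1 g2 : I -> I) :
  injective (fun a => (g1 a, g2 a)) ->
  (forall a, [|| g1 a == g2 a, par (g1 a) == g2 a | par (g2 a) == g1 a]) ->
  \sum_a slice P (g1 a) * (p - slice P (g2 a)) <= #|edge_cut (@blowup_rel I par p) P|.
Proof.
move=> inj_g adj_g.
pose A : {set I * ('I_p * 'I_p)} :=
  [set u | ((g1 u.1, u.2.1) \in P) && ((g2 u.1, u.2.2) \notin P)].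
pose F (u : I * ('I_p * 'I_p)) := ((g1 u.1, u.2.1), (g2 u.1, u.2.2)).
have injF : injective F.
  by move=> [a [i j]] [b [i' j']] [E1 -> E2 ->]; congr (_, _); apply: inj_g; rewrite E1 E2.
have -> : \sum_a slice P (g1 a) * (p - slice P (g2 a)) = #|A|.
  rewrite card_slices; apply: eq_bigr => a _.
  have -> : [set i | (a, i) \in A] =
      setX [set i | (g1 a, i) \in P] (~: [set i | (g2 a, i) \in P]).
    by apply/setP=> -[i j]; rewrite !inE.
  rewrite cardsX /slice; congr (_ * _).
  by have := cardsC [set i | (g2 a, i) \in P]; rewrite card_ord; lia.
rewrite -(card_imset _ injF); apply/subset_leq_card/subsetP=> q /imsetP[u].
rewrite inE => /andP[u1 u2] ->; rewrite inE /= u1 u2 /blowup_rel /= adj_g !andbT.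
by apply: contraNneq u2 => <-.
Qed.

(* [P] is rounded to the set of nodes at least half of whose clique lies in [P];
   the rounding error and the boundary of the rounded set are both paid for by
   cut edges. *)
Lemma btree_blowup_cut (h p t : nat) (P : {set btree h * 'I_p}) :
  0 < p -> #|P| = p * quarter_sum t ->
  p * p * t <= 10 * #|edge_cut (blowup_rel (@bparent h) (p := p)) P| + 2 * (p * p).
Proof.
move=> p_gt0 cardP.
set cut := #|edge_cut _ _|.
pose f := slice P; have f_le a : f a <= p := slice_le P a.
pose r (a : btree h) := p <= 2 * f a.
have cut_diag : \sum_a f a * (p - f a) <= cut.
  by apply: (@blowup_cut_ge _ _ _ _ id id) => [a b []//|a]; rewrite eqxx.
have cut_up : \sum_a f a * (p - f (bparent a)) <= cut.
  by apply: (@blowup_cut_ge _ _ _ _ id (@bparent h)) => [a b []//|a]; rewrite eqxx orbT.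
have cut_down : \sum_a f (bparent a) * (p - f a) <= cut.
  by apply: (@blowup_cut_ge _ _ _ _ (@bparent h) id) => [a b []//|a]; rewrite eqxx !orbT.
set X := \sum_(c : btree h) (r c != r (bparent c)).
set s := \sum_(c : btree h) r c.
(* If [2 * u >= p > 2 * v], then [u * (p - v) + v * (p - u)] is at least [p^2 / 2]. *)
have boundX : X * (p * p) <= 4 * cut.
  have : X * (p * p) <= \sum_a 2 * (f a * (p - f (bparent a)) + f (bparent a) * (p - f a)).
    rewrite /X big_distrl; apply: leq_sum => a _; rewrite /r.
    move: (f_le a) (f_le (bparent a)); move: (f a) (f _) => u v le_u le_v.
    by case: (leqP p (2 * u)) => cu; case: (leqP p (2 * v)) => cv /=; nia.
  by rewrite -big_distrr big_split /=; lia.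
have sumf : \sum_a f a = p * quarter_sum t by rewrite -cardP card_slices.
(* At each node the rounding error [|p * f a - p^2 * r a|] is at most [2 * f a * (p - f a)]; [above]
   and [below] sum its two signs. *)
have above : p * (p * quarter_sum t) <= p * p * s + 2 * cut.
  have : p * \sum_a f a <= \sum_a (p * p * r a + 2 * (f a * (p - f a))).
    rewrite big_distrr; apply: leq_sum => a _; rewrite /r.
    move: (f_le a); move: (f a) => u le_u.
    by case: (leqP p (2 * u)) => cu /=; nia.
  by rewrite big_split -!big_distrr sumf /=; lia.
have below : p * p * s <= p * (p * quarter_sum t) + 2 * cut.
  have : \sum_a p * p * r a <= \sum_a (p * f a + 2 * (f a * (p - f a))).
    apply: leq_sum => a _; rewrite /r.
    move: (f_le a); move: (f a) => u le_u.
    by case: (leqP p (2 * u)) => cu /=; nia.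
  by rewrite big_split -!big_distrr sumf /=; lia.
pose d := (Z.of_nat (quarter_sum t) - Z.of_nat s)%Z.
have rep_root : signed_pow_sum 2 (Z.of_nat (r (broot h) * (2 ^ h.+1 - 1))).
  have pos : 0 < 2 ^ h.+1 by rewrite expn_gt0.
  have R1 := SignedPowB 0 (SignedPowD h.+1 SignedPow0).
  (* Zero is written as [1 - 1], so that both cases use exactly two summands. *)
  have R0 := SignedPowB 0 (SignedPowD 0 SignedPow0).
  case: (r _); rewrite ?mul1n ?mul0n.
  - by congr signed_pow_sum: R1; lia.
  - by congr signed_pow_sum: R0; lia.
(* [quarter_sum t] is [s] plus the rounding error [d], and [d] is spelled out in units. *)
have le_t : t <= 2 * X + 2 + Z.abs_nat d.
  apply: signed_pow_sum_quarter.
  have := signed_pow_sumD (signed_pow_sumD (btree_signed_pow_sum r) rep_root)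
            (signed_pow_sum_unary d).
  by congr signed_pow_sum; rewrite Z.sub_add /d -/s; lia.
have le_d : Z.abs_nat d * (p * p) <= 2 * cut.
  move: above below; rewrite /d; move: (quarter_sum t) => q; move: (s) => n ab be.
  case: (leqP n q) => nq.
    have -> : Z.abs_nat (Z.of_nat q - Z.of_nat n) = q - n by lia.
    by nia.
  have -> : Z.abs_nat (Z.of_nat q - Z.of_nat n) = n - q by lia.
  by nia.
(* The factor 10 is [2 * 4] from [2 * X] plus 2 from [d]. *)
move: (p * p) boundX le_d => P2; nia.
Qed.

(** * Lower bounds on the partial matching width *)

Lemma pmw_lower (T : finType) (e : rel T) (V : {set T}) (m j : nat) :
  j <= #|V| -> m <= #|T| ->
  (forall P : {set T}, #|P| = j -> exists2 M, cross_matching e P M & m <= #|M|) ->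
  m <= pmw e V.
Proof.
move=> le_j le_m HP.
have Hm : pmw_ge e V m.
  apply/forallP=> s; apply/implyP=> perm_s.
  have lt_j : j < #|V|.+1 by [].
  apply/existsP; exists (Ordinal lt_j); apply/existsP.
  have uniq_s : uniq s by rewrite (perm_uniq perm_s) enum_uniq.
  have cardP : #|[set x in take j s]| = j.
    rewrite cardsE; have /card_uniqP-> := take_uniq j uniq_s.
    by rewrite size_takel // size_tuple.
  by have [M HM leM] := HP _ cardP; exists M; rewrite HM.
(* [pmw] is a maximum over a range ending at [#|T|], so [m] has to lie in it. *)
have lt_m : m < #|T|.+1 by [].
exact: (leq_bigmax_cond (Ordinal lt_m)).
Qed.

Lemma btree_blowup_pmw (h p t : nat) (V : {set btree h * 'I_p}) :
  0 < p -> p * 4 ^ t <= #|V| ->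
  p * (t - 2) <= 100 * pmw (blowup_rel (@bparent h) (p := p)) V.
Proof.
move=> p_gt0 leV.
(* A ceiling. With degree bound [5 * p], the cut is at most [10 * p * #|M|], and the factor 10 of
   the cut bound makes 100. *)
pose m := (p * (t - 2) + 99) %/ 100.
suff : m <= pmw (blowup_rel (@bparent h) (p := p)) V by rewrite /m; move: (p * (t - 2)) => x; lia.
have le_t : t <= 4 ^ t by rewrite ltnW // ltn_expl.
have q_le := quarter_sum_le t.
apply: (@pmw_lower _ _ _ _ (p * quarter_sum t)).
  by rewrite (leq_trans _ leV) // leq_mul2l q_le orbT.
  apply: leq_trans (leq_trans leV (max_card _)).
  suff : p * (t - 2) <= p * 4 ^ t.
    by rewrite /m; move: (p * (t - 2)) (p * 4 ^ t) => x y; lia.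
  by rewrite leq_mul2l; lia.
move=> P cardP.
have [sym_e _] := blowup_rel_simple (@bparent h) p.
have [M HM le_cut] := edge_cut_matching P sym_e (blowup_degree (@bparent_children h)).
exists M => //.
have := btree_blowup_cut p_gt0 cardP.
move: le_cut; move: #|edge_cut _ _| #|M| => c n; rewrite /m => le_c le_p.
suff : p * (t - 2) <= 100 * n by lia.
rewrite -(leq_pmul2l p_gt0); nia.
Qed.

(** * The graph class and the logarithmic estimate *)

Inductive btree_blowup (p : nat) : forall T : finType, rel T -> Prop :=
  BtreeBlowup h : btree_blowup p (blowup_rel (@bparent h) (p := p)).

Lemma INR_expn (m n : nat) : INR (m ^ n) = (INR m ^ n)%R.
Proof. by elim: n => [|n IH] //; rewrite expnS mult_INR IH. Qed.

Lemma log2_le_nat (n b : nat) : 0 < n -> n <= 2 ^ b -> (log2 (INR n) <= INR b)%R.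
Proof.
move=> n_gt0 le_n; rewrite /log2.
have ln2 := ln_lt_2.
have n_pos : (0 < INR n)%R by apply: lt_0_INR; lia.
apply: (Rmult_le_reg_r (ln 2)); first by lra.
rewrite /Rdiv Rmult_assoc Rinv_l ?Rmult_1_r; last by lra.
have -> : (INR b * ln 2 = ln (INR (2 ^ b)))%R.
  by rewrite INR_expn -ln_pow //; lra.
case: (le_INR n (2 ^ b)) => [|lt_n|<-]; [lia | left | by right].
exact: ln_increasing.
Qed.

(* Since [p <= sqrt #|V| / 2], the largest [t] with [p 4^t <= #|V|] satisfies
   [log #|V| <= 4 t + 2], and [2^20 <= #|V|] makes [t - 2] comparable to [t]. *)
Theorem theorem2 :
  exists c0 c1 c2 : R, (1 <= c0)%R /\ (1 <= c1)%R /\ (1 <= c2)%R /\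
  exists K : nat -> Prop,
    (forall n : nat, exists k, (n <= k)%coq_nat /\ K k) /\
    forall k : nat, K k ->
      (c0 <= INR k)%R /\
      exists C : forall T : finType, rel T -> Prop,
        (forall n : nat, exists (T : finType) (e : rel T), C T e /\ (n <= #|T|)%coq_nat) /\
        forall (T : finType) (e : rel T), C T e ->
          simple_graph e /\ treewidth_le e k /\
          forall V : {set T},
            (Rpower (INR k) c1 <= INR #|V|)%R ->
            (INR k * log2 (INR #|V|) / c2 <= INR (pmw e V))%R.
Proof.
(* The exponent 20 gives [(2 * p)^20 <= #|V|], whence [5 <= t]. With [log #|V| <= 4 * t + 2], the
   constant 1500 requires [8 * t + 4 <= 15 * (t - 2)], which holds from [t = 5] on. *)
exists 1%R, 20%R, 1500%R; do 3 (split; first by lra).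
exists (fun k => exists2 p, 0 < p & k = 2 * p); split.
  by move=> n; exists (2 * n.+1); split; [lia | exists n.+1].
move=> k [p p_gt0 ->].
have p_ge1 : (1 <= INR p)%R by apply: (le_INR 1); lia.
have INR2p : INR (2 * p) = (2 * INR p)%R by rewrite mult_INR.
split; first by lra.
exists (btree_blowup p); split.
  move=> n; exists (btree n * 'I_p)%type, (blowup_rel (@bparent n) (p := p)).
  split; first by constructor.
  by rewrite card_prod card_ord; have := card_btree_gt n; nia.
move=> T e [h]; split; first exact: blowup_rel_simple.
split.
  apply: blowup_treewidth; apply: (tree_rel_is_tree (root := broot h) (rank := @bdepth h)).
    exact: bparent_root.
  exact: bdepth_parent.
move=> V; have -> : 20%R = INR 20 by rewrite INR_IZR_INZ.
rewrite Rpower_pow; last by lra.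
set n := #|V| => le_n.
have n_large : 2 ^ 20 * p ^ 2 <= n.
  apply/leP/INR_le; apply: Rle_trans le_n.
  rewrite INR2p mult_INR !INR_expn Rpow_mult_distr (_ : INR 2 = 2%R) //.
  apply: Rmult_le_compat_l; first by apply: pow_le; lra.
  by apply: Rle_pow => //; lia.
have p_n : 4 * (p * p) <= n.
  apply: leq_trans n_large; rewrite -[p * p]/(p ^ 2) leq_mul2r.
  by rewrite (leq_pexp2l (m := 2) (n1 := 2)) // orbT.
have p_le_n : p <= n by nia.
have n_pos : 0 < n by lia.
set t := trunc_log 4 (n %/ p).
have p_le : 0 < n %/ p.
  by rewrite divn_gt0 //; lia.
have [lo hi] : 4 ^ t <= n %/ p /\ n %/ p < 4 ^ t.+1.
  by have /andP := @trunc_log_bounds 4 (n %/ p) isT p_le.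
have lo' : p * 4 ^ t <= n by rewrite mulnC -leq_divRL.
have hi' : n < p * 4 ^ t.+1 by rewrite mulnC -ltn_divLR.
(* Squaring [hi'] gives [n^2 <= 4 * p^2 * 2^(4 * t + 2)]; replacing [4 * p^2] by [n] and cancelling
   [n] removes [p]. *)
have n_le : n <= 2 ^ (4 * t + 2).
  have E : 4 ^ t.+1 * 4 ^ t.+1 = 4 * 2 ^ (4 * t + 2).
    by rewrite -expnD -[4]/(2 ^ 2) -!expnM -expnD; congr expn; lia.
  have le_nn : n * n <= 4 * (p * p) * 2 ^ (4 * t + 2).
    by rewrite [4 * (p * p)]mulnC -mulnA -E mulnACA; apply: leq_mul; lia.
  rewrite -(leq_pmul2l n_pos); apply: leq_trans le_nn _.
  by rewrite leq_mul2r p_n orbT.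
have t_ge5 : 5 <= t.
  have : 2 ^ 20 <= 2 ^ (4 * t + 2).
    by apply: leq_trans n_le; apply: leq_trans n_large; rewrite leq_pmulr ?expn_gt0 ?p_gt0.
  by rewrite leq_exp2l //; lia.
have log_n := log2_le_nat n_pos n_le.
have /leP/le_INR := btree_blowup_pmw p_gt0 lo'.
rewrite !mult_INR minus_INR; last by lia.
move: log_n; rewrite plus_INR mult_INR.
have -> : INR 100 = 100%R by rewrite INR_IZR_INZ.
have := le_INR _ _ (elimT leP t_ge5).
rewrite (INR_IZR_INZ 5) (INR_IZR_INZ 4) (INR_IZR_INZ 2) /=.
move: (INR t) (INR (pmw _ _)) (log2 _) (INR p) p_ge1 => x y l q; nra.
Qed.
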